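(* Let $G=(V,E)$ be a graph, $R\subseteq V$ a set of landmarks, $B$ a batch update turning $G$ into $G'$, and $\Gamma$ the unique minimal highway cover labelling (with landmark set $R$) over $G$. Then the highway cover labelling $\Gamma'$ returned by the algorithm BatchHL on input $(G',B,R,\Gamma)$ is the minimal highway cover labelling (with landmark set $R$) over $G'$, regardless of whether the basic or the improved version of the subroutine BatchSearch is used.
   Context: **Graphs and updates.** Graphs are finite, unweighted and undirected. $d_G(s,t)\in\mathbb N\cup\{\infty\}$ is the shortest-path distance ($\infty$ if no path exists); $N_{G'}(v)$ is the set of neighbours of $v$ in $G'$. A batch update $B$ is a finite set of edge updates $(a,b)$, each either an insertion of an edge not in $G$ or a deletion of an edge of $G$, with no edge both inserted and deleted; applying all of them to $G$ yields $G'$, on the same vertex set $V$. **Highway cover labelling.** Fix a set $R\subseteq V$ of landmarks. A label $L(v)$ of $v\in V$ in $G$ is a set of entries $(r,\delta_L(r,v))$, at most one for each $r\in R$, with $\delta_L(r,v)=d_G(r,v)$; the entry for $r$ is the $r$-label of $v$. The highway is $H=(R,\delta_H)$ with $\delta_H(r_1,r_2)=d_G(r_1,r_2)$ for all $r_1,r_2\in R$. A highway cover labelling over $G$ is $\Gamma=(H,L)$ with $L=\{L(v)\}_{v\in V}$ such that for all $v\in V\setminus R$ and $r\in R$, $$d_G(r,v)=\min\{\delta_L(r_i,v)+\delta_H(r,r_i)\mid (r_i,\delta_L(r_i,v))\in L(v)\}$$ (with $\min\emptyset=\infty$). Its size is $\sum_{v\in V}|L(v)|$. It is minimal if no highway cover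 labelling over $G$ with the same $R$ has smaller size. For fixed $R$ it is known that there is a unique minimal highway cover labelling, contained in every highway cover labelling. The labelling $\Gamma$ determines all values $d_G(r,v)$ and $d^L_G(r,v)$ (defined below) for $r\in R$, $v\in V$. **Landmark length.** For a path $p$ starting at $r\in R$, its landmark length is $(d,l)$, where $d$ is the number of edges of $p$ and $l\in\{\mathrm{True},\mathrm{False}\}$ is $\mathrm{True}$ iff $p$ passes through (possibly ends in) a landmark other than $r$. Tuples are compared lexicographically, with $\mathrm{True}<\mathrm{False}$. $d^L_G(r,v)$ is the minimal landmark length of paths between $r$ and $v$ in $G$, with $d^L_G(r,v)=(\infty,\mathrm{False})$ if there is none. Put $(d,l)\oplus w:=(d+1,\mathrm{True})$ if $w\in R$ and $(d+1,l)$ otherwise; the convention is $(\infty,l)\oplus w=(\infty,\mathrm{False})$. Put $\beta(r,v):=(d^L_G(r,v),\mathrm{True})$, a triple. Nested tuples are flattened. **BatchHL$(G',B,R,\Gamma)$.** Initialise $\Gamma':=\Gamma$. For each $r\in R$: compute $V_{\mathrm{aff}}:=$ BatchSearch$(G',B,r,\Gamma)$, then run BatchRepair$(G',V_{\mathrm{aff}},r,\Gamma,\Gamma')$. Return $\Gamma'$. **Basic BatchSearch$(G',B,r,\Gamma)$.** Start with an empty priority queue $Q$ and $V_+=\emptyset$. For each $(a,b)\in B$: if $d_G(r,a)<d_G(r,b)$ add $(d_G(r,a)+1,b)$ to $Q$; if $d_G(r,a)>d_G(r,b)$ add $(d_G(r,b)+1,a)$ to $Q$. While $Q$ is not empty: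 remove a minimal $(d,v)$ from $Q$; if $v\notin V_+$, add $v$ to $V_+$ and for every $w\in N_{G'}(v)$ with $d+1\le d_G(r,w)$ add $(d+1,w)$ to $Q$. Return $V_+$. **Improved BatchSearch$(G',B,r,\Gamma)$.** Start with an empty priority queue $Q$ and $V_+=\emptyset$. For each $(a,b)\in B$, let $e=\mathrm{True}$ iff $(a,b)$ is a deletion; if $d_G(r,a)<d_G(r,b)$ add $(d^L_G(r,a)\oplus b,\,e,\,b)$ to $Q$; if $d_G(r,a)>d_G(r,b)$ add $(d^L_G(r,b)\oplus a,\,e,\,a)$ to $Q$. While $Q$ is not empty: remove a minimal $(d,l,e,v)$ from $Q$ (lexicographic, $\mathrm{True}<\mathrm{False}$); if $v\notin V_+$, add $v$ to $V_+$ and for every $w\in N_{G'}(v)$ let $d_w:=((d,l)\oplus w,\,e)$ and, if $d_w\le\beta(r,w)$, add $(d_w,w)$ to $Q$. Return $V_+$. **BatchRepair$(G',V_{\mathrm{aff}},r,\Gamma,\Gamma')$.** For each $v\in V_{\mathrm{aff}}$ set $D[v]:=\min\{d^L_G(r,w)\oplus v\mid w\in N_{G'}(v)\setminus V_{\mathrm{aff}}\}$ (computed from $\Gamma$; $(\infty,\mathrm{False})$ if the set is empty). While $V_{\mathrm{aff}}\ne\emptyset$: let $V_{\min}$ be the set of $v\in V_{\mathrm{aff}}$ whose $D[v]$ has minimal distance component; remove $V_{\min}$ from $V_{\mathrm{aff}}$; for each $v\in V_{\min}$ with $D[v]=(d,l)$: if $d=\infty$ or $l=\mathrm{True}$, remove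 the $r$-label of $v$ from $\Gamma'$ (if any), otherwise set the $r$-label of $v$ in $\Gamma'$ to $(r,d)$; if $v\in R$, set the highway distance between $r$ and $v$ in $\Gamma'$ to $d$; and for each $w\in N_{G'}(v)\cap V_{\mathrm{aff}}$ set $D[w]:=\min(D[w],D[v]\oplus w)$. *)

(* Defs.v *)
From HB Require Import structures.
From mathcomp Require Import all_boot all_order.

Set Implicit Arguments.
Unset Strict Implicit.
Unset Printing Implicit Defensive.

Import Order.TTheory.

(* Extended naturals, ordered with Infty as the greatest element. *)

Inductive enat := Fin of nat | Infty.

Definition enat_to_option x := if x is Fin n then Some n else None.
Definition enat_of_option o := if o is Some n then Fin n else Infty.
Lemma enat_to_optionK : cancel enat_to_option enat_of_option.
Proof. by case. Qed.

HB.instance Definition _ := Countable.copy enat (can_type enat_to_optionK).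

Definition le_enat (x y : enat) : bool :=
  match x, y with
  | _, Infty => true
  | Infty, Fin _ => false
  | Fin m, Fin n => (m <= n)%N
  end.

Definition lt_enat (x y : enat) : bool := (y != x) && le_enat x y.
Definition min_enat (x y : enat) := if lt_enat x y then x else y.
Definition max_enat (x y : enat) := if lt_enat x y then y else x.

Lemma le_enat_anti : antisymmetric le_enat.
Proof. by case=> [m|] [n|] //=; rewrite -eqn_leq => /eqP->. Qed.

Lemma le_enat_trans : transitive le_enat.
Proof. by case=> [n|] [m|] [p|] //=; apply: leq_trans. Qed.

Lemma le_enat_total : total le_enat.
Proof. by case=> [m|] [n|] //=; apply: leq_total. Qed.

HB.instance Definition _ :=
  Order.isOrder.Build (Order.Disp tt tt) enat
    (fun _ _ => erefl) (fun _ _ => erefl) (fun _ _ => erefl)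
    le_enat_anti le_enat_trans le_enat_total.

Lemma le_Fin m n : (Fin m <= Fin n)%O = (m <= n)%N.
Proof. by []. Qed.

Definition enat_add (x y : enat) : enat :=
  if x is Fin m then if y is Fin n then Fin (m + n) else Infty else Infty.

Definition enat_succ (x : enat) : enat := if x is Fin n then Fin n.+1 else Infty.

Lemma bigmin_attained (disp : Order.disp_t) (T : orderType disp) (I : finType)
    (x : T) (P : pred I) (F : I -> T) (m : T) :
  m = \big[Order.min/x]_(i | P i) F i -> m = x \/ exists2 i, P i & m = F i.
Proof.
move=> ->; elim/big_ind: _ => [|y z Ky Kz|i Pi]; [by left | | by right; exists i].
by case: (leP y z).
Qed.

(* Landmark lengths (d, l) and triples (d, l, e), compared lexicographically;
   bool^d is bool with the reversed order, so that true < false. *)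
Definition llen : Type := (enat *l bool^d)%type.
Definition lkey : Type := (llen *l bool^d)%type.

Definition mk_llen (d : enat) (l : bool) : llen := (d, l).
Definition mk_lkey (dl : llen) (e : bool) : lkey := (dl, e).

Definition llen_inf : llen := mk_llen Infty false.

Record sgraph (V : finType) := SGraph {
  adj :> rel V;
  adj_sym : symmetric adj;
  adj_irrefl : irreflexive adj
}.

Section Graphs.
Variables (V : finType) (G : sgraph V) (R : {set V}).
Implicit Types (r s t u v w : V) (p : seq V).

Definition nbr v : {set V} := [set w | G v w].

(* A path from s to t is given by the list p of its vertices after s, so that
   size p is its number of edges. *)
Definition spath s t p : bool :=
  [&& path G s p, last s p == t & uniq (s :: p)].

(* The bound on n excludes nothing, as the vertices of a path are distinct. *)
Definition dist s t : enat :=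
  \big[Order.min/Infty]_(n < #|V|)
    \big[Order.min/Infty]_(p : n.-tuple V | spath s t p) Fin (size p).

Definition path_llen r p : llen :=
  mk_llen (Fin (size p)) (has (fun x => (x \in R) && (x != r)) p).

Definition ldist r v : llen :=
  \big[Order.min/llen_inf]_(n < #|V|)
    \big[Order.min/llen_inf]_(p : n.-tuple V | spath r v p) path_llen r p.

Definition oplus (dl : llen) w : llen :=
  if dl.1 is Fin d then mk_llen (Fin d.+1) ((w \in R) || dl.2)
  else llen_inf.

Lemma spath_size s t p : spath s t p -> size p < #|V|.
Proof.
by case/and3P=> _ _ /card_uniqP E; rewrite -[(size p).+1]/(size (s :: p)) -E max_card.
Qed.

Lemma dist_le_spath s t p : spath s t p -> (dist s t <= Fin (size p))%O.
Proof.
move=> hp; apply: (bigmin_inf (Ordinal (spath_size hp))) => //.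
by apply: (bigmin_inf (in_tuple p)).
Qed.

Lemma dist_attained s t :
  dist s t = Infty \/ exists2 p, spath s t p & dist s t = Fin (size p).
Proof.
case: (bigmin_attained (erefl (dist s t))) => [|[n _ /bigmin_attained]]; first by left.
case=> [|[p hp E]]; first by left.
by right; exists p.
Qed.

Lemma ldist_le_spath r v p : spath r v p -> (ldist r v <= path_llen r p)%O.
Proof.
move=> hp; apply: (bigmin_inf (Ordinal (spath_size hp))) => //.
by apply: (bigmin_inf (in_tuple p)).
Qed.

Lemma ldist_attained r v :
  ldist r v = llen_inf \/ exists2 p, spath r v p & ldist r v = path_llen r p.
Proof.
case: (bigmin_attained (erefl (ldist r v))) => [|[n _ /bigmin_attained]]; first by left.
case=> [|[p hp E]]; first by left.
by right; exists p.
Qed.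

Lemma dist_le_walk s t p :
  path G s p -> last s p = t -> (dist s t <= Fin (size p))%O.
Proof.
move=> hp ht; case/shortenP: hp ht => p' hp' up' sub ht.
apply: le_trans (dist_le_spath (p := p') _) _; first by rewrite /spath hp' ht eqxx.
by apply: uniq_leq_size => //; case/andP: up'.
Qed.

Lemma dist_refl s : dist s s = Fin 0.
Proof.
have := @dist_le_walk s s [::] isT erefl.
by case: (dist s s) => [[|n]|].
Qed.

Lemma dist_eq0 s t : dist s t = Fin 0 -> s = t.
Proof.
case: (dist_attained s t) => [->|[[|x p] + ->]] //.
by case/and3P=> _ /eqP.
Qed.

Lemma dist_triangle s u t : (dist s t <= enat_add (dist s u) (dist u t))%O.
Proof.
case: (dist_attained s u) => [->|[p /and3P[hp /eqP lp _] ->]].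
  by case: (dist s t).
case: (dist_attained u t) => [->|[q /and3P[hq /eqP lq _] ->]].
  by case: (dist s t).
rewrite /= -size_cat; apply: dist_le_walk; first by rewrite cat_path hp lp.
by rewrite last_cat lp.
Qed.

Lemma ldist_dist r v : (ldist r v).1 = dist r v.
Proof.
apply/le_anti/andP; split.
  case: (dist_attained r v) => [->|[p hp ->]]; first by case: (ldist r v).1.
  by have := ldist_le_spath hp; rewrite leEprodlexi => /andP[].
case: (ldist_attained r v) => [->|[p hp ->]]; first by case: (dist r v).
exact: dist_le_spath.
Qed.

Definition through r v : bool :=
  [exists s in R, (s != r) && (enat_add (dist r s) (dist s v) == dist r v)].

Lemma ldist_through r v : (ldist r v).2 = (dist r v != Infty) && through r v.
Proof.
apply/idP/andP=> [h|[fin_rv /exists_inP[s Rs /andP[sr /eqP E]]]].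
  case: (ldist_attained r v) h (ldist_dist r v) => [->|[p hp ->]] // h.
  rewrite [_.1]/= => E; rewrite -E; split=> //.
  case/hasP: h => s sp /andP[Rs sr]; apply/exists_inP; exists s => //.
  rewrite sr /= -E; apply/eqP/le_anti/andP; split; last first.
    by rewrite E; apply: dist_triangle.
  case/and3P: hp => hp /eqP lp _; case/splitPr: sp hp lp {E} => p1 p2.
  rewrite cat_path last_cat /= => /and3P[h1 h2 h3] h4.
  have := @dist_le_walk r s (rcons p1 s); rewrite rcons_path h1 h2 last_rcons size_rcons.
  move=> /(_ isT erefl); have := dist_le_walk h3 h4.
  case: (dist r s) => [a|//]; case: (dist s v) => [b|//] /= lb la.
  by rewrite size_cat /= -addSnnS; apply: leq_add.
case: (dist_attained r s) => [E1|[p hp E1]]; first by rewrite -E E1 in fin_rv.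
case: (dist_attained s v) => [E2|[q hq E2]].
  by rewrite -E E1 E2 in fin_rv.
case/and3P: hp hq => hp /eqP lp _ /and3P[hq /eqP lq _].
have hpq : path G r (p ++ q) by rewrite cat_path hp lp.
have lpq : last r (p ++ q) = v by rewrite last_cat lp.
have Erv : dist r v = Fin (size (p ++ q)) by rewrite -E E1 E2 size_cat.
have spq : spath r v (p ++ q).
  rewrite /spath hpq lpq eqxx /=; case/shortenP: (hpq) lpq => p' hp' up' sub lp'.
  apply: (@leq_size_uniq _ _ (r :: p ++ q) up') => [x|].
    by rewrite !inE => /predU1P[->|/sub->]; rewrite ?eqxx ?orbT.
  have := @dist_le_spath r v p'; rewrite /spath hp' up' lp' eqxx => /(_ isT).
  by rewrite Erv.
have := ldist_le_spath spq; rewrite leEprodlexi ldist_dist Erv /= => /andP[_].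
rewrite lexx /=; suff -> : has (fun x => (x \in R) && (x != r)) (p ++ q).
  by case: (ldist r v).2.
apply/hasP; exists s; last by rewrite Rs sr.
rewrite mem_cat -lp; case: p lp {hp E1 hpq lpq Erv spq} => [|x p] lp /=.
  by rewrite -lp eqxx in sr.
by rewrite mem_last.
Qed.

End Graphs.

(* [label Gamma v r = Some d] means that (r, d) belongs to L(v); [hwy Gamma] is
   the highway, whose values outside R x R are meaningless and never used. *)
Record labelling (V : finType) := Labelling {
  hwy : V -> V -> enat;
  label : V -> V -> option enat
}.

Section Labellings.
Variables (V : finType) (R : {set V}).
Implicit Types (G : sgraph V) (Gamma : labelling V) (r v : V).

Definition cover_dist Gamma r v : enat :=
  \big[Order.min/Infty]_(ri | isSome (label Gamma v ri))
    enat_add (odflt Infty (label Gamma v ri)) (hwy Gamma r ri).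

Definition hc_labelling G Gamma : Prop :=
  [/\ forall v r d, label Gamma v r = Some d -> r \in R /\ d = dist G r v,
      forall r1 r2, r1 \in R -> r2 \in R -> hwy Gamma r1 r2 = dist G r1 r2
    & forall v r, v \notin R -> r \in R -> dist G r v = cover_dist Gamma r v].

Definition labelling_size Gamma : nat :=
  \sum_(v : V) #|[set r | isSome (label Gamma v r)]|.

Definition minimal_hc_labelling G Gamma : Prop :=
  hc_labelling G Gamma /\
  forall Gamma1, hc_labelling G Gamma1 ->
    (labelling_size Gamma <= labelling_size Gamma1)%N.

(* The values d_G(r,v) and d^L_G(r,v), read off from the minimal highway cover
   labelling Gamma over G: see known_distE and known_ldistE below. *)
Definition known_dist Gamma r v : enat :=
  if v \in R then hwy Gamma r v else cover_dist Gamma r v.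

Definition known_ldist Gamma r v : llen :=
  let d := known_dist Gamma r v in
  mk_llen d [&& v != r, d != Infty & ~~ isSome (label Gamma v r)].

Lemma known_distE G Gamma r v :
  hc_labelling G Gamma -> r \in R -> known_dist Gamma r v = dist G r v.
Proof.
case=> _ hH hL Rr; rewrite /known_dist.
by case: ifPn => Rv; [apply: hH | rewrite hL].
Qed.

Lemma label_needed G Gamma r v :
  hc_labelling G Gamma -> v \notin R -> r \in R -> dist G r v != Infty ->
  ~~ through G R r v -> isSome (label Gamma v r).
Proof.
case=> hE hH hL Rv Rr fin nthr; have := hL _ _ Rv Rr.
case/bigmin_attained => [E|[s hs E]]; first by rewrite E in fin.
have [<- //|sr] := eqVneq s r.
case El : (label Gamma v s) hs E => [d|//] _ /= E.
have [Rs Ed] := hE _ _ _ El.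
case/negP: nthr; apply/exists_inP; exists s => //.
rewrite sr E Ed hH //=; case: (dist G r s) => [a|]; case: (dist G s v) => [b|] //=.
by rewrite addnC.
Qed.

Definition canonical_labelling G : labelling V :=
  Labelling (dist G)
    (fun v r => if [&& v \notin R, r \in R, dist G r v != Infty & ~~ through G R r v]
                then Some (dist G r v) else None).

Lemma canonical_labellingP G : hc_labelling G (canonical_labelling G).
Proof.
split=> [v r d /=|//|v r Rv Rr].
  by case: ifP => // /and4P[_ Rr _ _] [<-].
rewrite /cover_dist /=; apply/le_anti/andP; split.
  apply: le_bigmin => [|s]; first by case: (dist G r v).
  case: ifP => //= _ _; have := dist_triangle G r s v.
  by case: (dist G r s) => [a|]; case: (dist G s v) => [b|] //=; rewrite addnC.
case Erv : (dist G r v) => [n|]; last by case: (\big[_/_]_(_ | _) _).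
pose P s := (s \in R) && (enat_add (dist G r s) (dist G s v) == Fin n).
have Pr : P r by rewrite /P Rr dist_refl Erv /= eqxx.
pose val s := if dist G s v is Fin m then m else 0.
case: (arg_minnP val Pr) => s /andP[Rs /eqP Es] hmin.
case Ers : (dist G r s) Es => [a|//]; case Esv : (dist G s v) => [b|//] /= [Es].
have ns : ~~ through G R s v.
  apply/negP=> /exists_inP[t Rt /andP[ts]].
  rewrite Esv; case Est : (dist G s t) => [c|//]; case Etv : (dist G t v) => [e|//].
  move=> /eqP[Ec].
  have Pt : P t.
    rewrite /P Rt /=; apply/eqP/le_anti/andP; split; last first.
      by rewrite -Erv; apply: dist_triangle.
    have := dist_triangle G r s t; rewrite Ers Est Etv.
    by case: (dist G r t) => [f|//] /=; rewrite !le_Fin -Es -Ec addnA leq_add2r.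
  have := hmin t Pt; rewrite /val Esv Etv -Ec -{2}[e]add0n leq_add2r leqn0 => /eqP c0.
  by move: ts; rewrite (dist_eq0 (s := s) (t := t) (G := G)) ?eqxx // Est c0.
apply: (bigmin_inf s); rewrite Rv Rs Esv ns //= Ers /=.
by rewrite -Es addnC.
Qed.

Lemma minimal_labelE G Gamma r v :
  minimal_hc_labelling G Gamma ->
  isSome (label Gamma v r) =
    [&& v \notin R, r \in R, dist G r v != Infty & ~~ through G R r v].
Proof.
case=> hG hmin.
have sub u : [set s | isSome (label (canonical_labelling G) u s)]
               \subset [set s | isSome (label Gamma u s)].
  apply/subsetP=> s; rewrite !inE /=; case: ifP => // /and4P[Ru Rs fin nt] _.
  exact: label_needed hG Ru Rs fin nt.
suff /setP/(_ r) : [set s | isSome (label (canonical_labelling G) v s)]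
                 = [set s | isSome (label Gamma v s)].
  by rewrite !inE /= => <-; case: ifP.
apply/eqP; rewrite eqEcard sub /= leqNgt; apply/negP=> lt.
have := hmin _ (canonical_labellingP G); apply/negP; rewrite -ltnNge.
rewrite /labelling_size [X in X < _](bigD1 v) //= [X in _ < X](bigD1 v) //=.
by rewrite -addSn; apply: leq_add => //; apply: leq_sum => u _; apply: subset_leq_card (sub u).
Qed.

Lemma known_ldistE G Gamma r v :
  minimal_hc_labelling G Gamma -> r \in R -> known_ldist Gamma r v = ldist G R r v.
Proof.
move=> hG Rr; have [hc _] := hG.
rewrite [RHS]surjective_pairing ldist_dist ldist_through.
rewrite /known_ldist (known_distE v hc Rr) (minimal_labelE _ _ hG) Rr /=.
congr (_, _); case: (eqVneq (dist G r v) Infty) => [_|fin]; first by rewrite /= andbF.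
rewrite negb_and !negbK /=; have [->|vr] := eqVneq v r.
  apply/esym/negbTE/negP=> /exists_inP[s _ /andP[sr]].
  rewrite dist_refl; case E: (dist G r s) => [[|a]|//]; case: (dist G s r) => [b|//] //.
  by move=> _; rewrite (dist_eq0 E) eqxx in sr.
case Rv : (v \in R) => //=; apply/esym/exists_inP; exists v => //.
rewrite vr dist_refl /=; case: (dist G r v) fin => // n _ /=.
by rewrite addn0.
Qed.

End Labellings.

(* An update (a, b, e) concerns the undirected edge ab; it is a deletion if e
   is true and an insertion otherwise. *)
Definition batch (V : finType) : Type := {set V * V * bool}.

Section Batch.
Variables (V : finType) (B : batch V).

Definition updates (e : bool) (x y : V) : bool :=
  ((x, y, e) \in B) || ((y, x, e) \in B).

Definition batch_update (G : sgraph V) : Prop :=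
  [/\ forall x y, updates false x y -> ~~ G x y,
      forall x y, updates true x y -> G x y
    & forall x y, ~~ (updates false x y && updates true x y)].

Definition applies (G G' : sgraph V) : Prop :=
  forall x y, G' x y = updates false x y || (G x y && ~~ updates true x y).

End Batch.

(* The algorithm is nondeterministic: the order in which landmarks, vertices
   and equal minimal queue elements are processed is unspecified.  Each
   relation below relates an input to all the results of terminating runs. *)

Section SearchLoop.
Variables (V : finType) (disp : Order.disp_t) (K : orderType disp).
Variables (G' : sgraph V) (next : K -> V -> K) (bound : V -> K).
Implicit Types (Q : seq (K * V)) (A : {set V}) (k : K) (v w : V).

Definition minimal_in (Q : seq (K * V)) (x : K * V) : bool :=
  (x \in Q) && all (fun y => (x.1 <= y.1)%O) Q.

Inductive search_loop : seq (K * V) -> {set V} -> {set V} -> Prop :=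
| search_done A : search_loop [::] A A
| search_skip Q A A1 k v :
    minimal_in Q (k, v) -> v \in A ->
    search_loop (rem (k, v) Q) A A1 ->
    search_loop Q A A1
| search_visit Q A A1 k v :
    minimal_in Q (k, v) -> v \notin A ->
    search_loop (rem (k, v) Q ++
                 [seq (next k w, w) | w <- enum (nbr G' v) & (next k w <= bound w)%O])
                (v |: A) A1 ->
    search_loop Q A A1.

End SearchLoop.

Inductive version := Basic | Improved.

Section BatchHL.
Variables (V : finType) (G' : sgraph V) (B : batch V) (R : {set V}).
Variable Gamma : labelling V.
Implicit Types (r v w : V) (A : {set V}) (D : V -> llen).

Let d := known_dist R Gamma.
Let dL := known_ldist R Gamma.

Definition basic_seed r (u : V * V * bool) : seq (enat * V) :=
  let: (a, b, _) := u in
  if (d r a < d r b)%O then [:: (enat_succ (d r a), b)]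
  else if (d r b < d r a)%O then [:: (enat_succ (d r b), a)]
  else [::].

Definition basic_search r A : Prop :=
  search_loop G' (fun k _ => enat_succ k) (d r)
    (flatten [seq basic_seed r u | u <- enum B]) set0 A.

Definition improved_seed r (u : V * V * bool) : seq (lkey * V) :=
  let: (a, b, e) := u in
  if (d r a < d r b)%O then [:: (mk_lkey (oplus R (dL r a) b) e, b)]
  else if (d r b < d r a)%O then [:: (mk_lkey (oplus R (dL r b) a) e, a)]
  else [::].

Definition improved_search r A : Prop :=
  search_loop G' (fun (k : lkey) w => mk_lkey (oplus R k.1 w) k.2)
    (fun w => mk_lkey (dL r w) true)
    (flatten [seq improved_seed r u | u <- enum B]) set0 A.

Definition batch_search (ver : version) r A : Prop :=
  match ver with
  | Basic => basic_search r A
  | Improved => improved_search r A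
  end.

Definition repair_label r v (dl : llen) (Gam : labelling V) : labelling V :=
  let lab := if (dl.1 == Infty) || dl.2 then None else Some dl.1 in
  Labelling
    (fun x y => if (v \in R) && (((x, y) == (r, v)) || ((x, y) == (v, r)))
                then dl.1 else hwy Gam x y)
    (fun x y => if (x, y) == (v, r) then lab else label Gam x y).

(* One iteration of the inner loop, where A is V_aff after removing V_min. *)
Definition repair_vertex r A (st : (V -> llen) * labelling V) v :
    (V -> llen) * labelling V :=
  let: (D, Gam) := st in
  (fun w => if w \in nbr G' v :&: A then Order.min (D w) (oplus R (D v) w)
            else D w,
   repair_label r v (D v) Gam).

Definition argmin_dist A D : {set V} :=
  [set v in A | [forall u in A, ((D v).1 <= (D u).1)%O]].

Inductive repair_loop r :
    {set V} -> (V -> llen) -> labelling V -> labelling V -> Prop :=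
| repair_done D Gam : repair_loop r set0 D Gam Gam
| repair_step A D Gam D1 Gam1 Gam2 (s : seq V) :
    A != set0 ->
    perm_eq s (enum (argmin_dist A D)) ->
    foldl (repair_vertex r (A :\: argmin_dist A D)) (D, Gam) s = (D1, Gam1) ->
    repair_loop r (A :\: argmin_dist A D) D1 Gam1 Gam2 ->
    repair_loop r A D Gam Gam2.

Definition batch_repair r A : labelling V -> labelling V -> Prop :=
  repair_loop r A
    (fun v => \big[Order.min/llen_inf]_(w in nbr G' v :\: A) oplus R (dL r w) v).

Inductive landmark_loop (ver : version) :
    seq V -> labelling V -> labelling V -> Prop :=
| landmark_done Gam : landmark_loop ver [::] Gam Gam
| landmark_step r s A Gam Gam1 Gam2 :
    batch_search ver r A ->
    batch_repair r A Gam Gam1 ->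
    landmark_loop ver s Gam1 Gam2 ->
    landmark_loop ver (r :: s) Gam Gam2.

Definition batchHL (ver : version) (Gamma' : labelling V) : Prop :=
  exists2 s, perm_eq s (enum R) & landmark_loop ver s Gamma Gamma'.

End BatchHL.

(* Main.v *)
Require Import Defs.
From mathcomp Require Import all_boot all_order.

(* The landmark lengths from r are determined by local equations: the value is
   (0, False) at r, and elsewhere the least of the values L(u) (+) v over the
   neighbours u of v.  Hence BatchRepair, a Dijkstra search, computes the new
   values on V_aff as soon as r is outside V_aff and the old and new values agree
   off V_aff; V_aff may well be too large.

   Agreement off V_aff follows from the keys K(v) under which the vertices enter
   V_aff.  Write L and L' for the old and new values.
   Improved search: a shorter new path is noticed, L(u) <= L'(u) or
   K(u) <= (L'(u), False).  A broken old path is noticed, L'(u) <= L(u) or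
   K(u) <= (L(u), True), which is proved simultaneously with: a key (x, False)
   with x < L(u) is honest, L'(u) <= x.
   Basic search: K(u) <= d(u) on V_aff, so V_aff is closed under extending old
   shortest paths, and d(u) <= d'(u) or K(u) <= d'(u); therefore off V_aff the old
   and new shortest paths coincide.

   Finally, the labels written by BatchRepair are those of the canonical labelling
   of G', which is minimal as its labels occur in every highway cover labelling. *)

Set Implicit Arguments.
Unset Strict Implicit.
Unset Printing Implicit Defensive.

Import Order.TTheory.

(** * Orders on extended naturals, landmark lengths and keys *)

(** Since [bool^d] is reversed, comparing flags amounts to the implication from [y.2] to [x.2]. *)
Lemma le_llenE (x y : llen) :
  (x <= y)%O = (x.1 <= y.1)%O && ((y.1 <= x.1)%O ==> (y.2 ==> x.2)).
Proof. by case: x y => [d [|]] [d' [|]]; rewrite leEprodlexi. Qed.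

Lemma le_lkeyE (x y : lkey) :
  (x <= y)%O = (x.1 <= y.1)%O && ((y.1 <= x.1)%O ==> (y.2 ==> x.2)).
Proof. by case: x y => [d [|]] [d' [|]]; rewrite leEprodlexi. Qed.

Lemma llen_le_inf (x : llen) : (x <= llen_inf)%O.
Proof. by case: x => [[n|] [|]]; rewrite le_llenE. Qed.

Lemma le_fst_llen (x y : llen) : (x <= y)%O -> (x.1 <= y.1)%O.
Proof. by rewrite le_llenE => /andP[]. Qed.

Lemma lt_fst_llen (x y : llen) : (x.1 < y.1)%O -> (x < y)%O.
Proof. by move=> h; rewrite ltNge le_llenE negb_and -ltNge h. Qed.

Lemma le_fst_lkey (x y : lkey) : (x <= y)%O -> (x.1 <= y.1)%O.
Proof. by rewrite le_lkeyE => /andP[]. Qed.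

Lemma lt_fst_lkey (x y : lkey) : (x.1 < y.1)%O -> (x < y)%O.
Proof. by move=> h; rewrite ltNge le_lkeyE negb_and -ltNge h. Qed.

Lemma le_enat_infty (x : enat) : (x <= Infty)%O.
Proof. by case: x. Qed.

Lemma lt_Fin m n : (Fin m < Fin n)%O = (m < n)%N.
Proof. by rewrite !ltNge le_Fin -ltnNge. Qed.

Lemma le_enat_succ (x y : enat) : (enat_succ x <= enat_succ y)%O = (x <= y)%O.
Proof. by case: x y => [m|] [n|]. Qed.

Lemma lt_enat_succ (x y : enat) : (enat_succ x < enat_succ y)%O = (x < y)%O.
Proof. by rewrite !ltNge le_enat_succ. Qed.

Lemma enat_succ_le (x y : enat) : (x < y)%O -> (enat_succ x <= y)%O.
Proof. by case: x y => [m|] [n|]; rewrite ltNge // !le_Fin -ltnNge. Qed.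

Lemma lt_Fin_succ (x : enat) n : (enat_succ x < Fin n.+1)%O = (x < Fin n)%O.
Proof. exact: (lt_enat_succ x (Fin n)). Qed.

Lemma oplus_fst (V : finType) (R : {set V}) x w : (oplus R x w).1 = enat_succ x.1.
Proof. by case: x => [[n|] l]. Qed.

Lemma oplus_mono (V : finType) (R : {set V}) w :
  {homo (fun x => oplus R x w) : x y / (x <= y)%O}.
Proof.
move=> x y; case: x y => [[m|] l] [[n|] l'] /=; rewrite ?llen_le_inf // !le_llenE /=.
by rewrite !le_Fin !ltnS; case: (w \in R) => /andP[->] /=; rewrite ?implybT.
Qed.

(** * Landmark lengths *)

Section LocalEquations.
Variables (V : finType) (G : sgraph V) (R : {set V}) (r : V).
Implicit Types (u v w : V) (p : seq V).

(** Cutting out cycles either makes the walk strictly shorter, or keeps its length and then, by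
    counting, all its vertices, so that no landmark is lost. *)
Lemma ldist_le_walk v p :
  path G r p -> last r p = v -> (ldist G R r v <= path_llen R r p)%O.
Proof.
move=> hp ht; case/shortenP: hp ht => p' hp' up' sub ht.
apply: le_trans (ldist_le_spath R (p := p') _) _; first by rewrite /spath hp' ht eqxx.
have up : uniq p' by case/andP: up'.
rewrite le_llenE /= !le_Fin uniq_leq_size //=; apply/implyP=> le_p'.
have [_ eq_p] := uniq_min_size up sub le_p'.
by rewrite (eq_has_r eq_p) implybb.
Qed.

Lemma ldist_inf v : (ldist G R r v).1 = Infty -> ldist G R r v = llen_inf.
Proof. by case: (ldist_attained G R r v) => [|[p _ ->]]. Qed.

Lemma ldist_root : ldist G R r r = mk_llen (Fin 0) false.
Proof.
rewrite [LHS]surjective_pairing ldist_dist ldist_through dist_refl.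
suff /negbTE-> : ~~ through G R r r by [].
apply/negP=> /exists_inP[s _ /andP[sr]].
case E: (dist G r s) => [[|a]|//]; case: (dist G s r) => [b|//];
  rewrite dist_refl //.
by rewrite (dist_eq0 E) eqxx in sr.
Qed.

(** The root is treated apart: when [r] is a landmark, [oplus] counts a return to [r] as meeting
    one, while [path_llen] ignores [r]. *)
Lemma ldist_edge u v : G u v -> (ldist G R r v <= oplus R (ldist G R r u) v)%O.
Proof.
move=> Guv; have [->|vr] := eqVneq v r.
  rewrite ldist_root le_llenE /= oplus_fst.
  by case: (ldist G R r u) => [[n|] l].
case: (ldist_attained G R r u) => [->|[p /and3P[hp /eqP lp _] ->]].
  exact: llen_le_inf.
have := @ldist_le_walk v (rcons p v).
rewrite rcons_path hp lp Guv last_rcons => /(_ isT erefl).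
by rewrite /path_llen has_rcons size_rcons /= vr andbT.
Qed.

(** Deleting the last edge of an optimal path leaves a walk to [u] no better than the optimum there;
    monotonicity of [oplus] carries this back to [v]. *)
Lemma ldist_pred v : v != r -> ldist G R r v = llen_inf \/
  exists u, [/\ G u v, (ldist G R r u).1 != Infty
              & ldist G R r v = oplus R (ldist G R r u) v].
Proof.
move=> vr; case: (ldist_attained G R r v) => [->|[p /and3P[hp /eqP lp _] E]].
  by left.
right; case/lastP: p => [|p v'] in hp lp E; first by rewrite -lp eqxx in vr.
rewrite last_rcons in lp; rewrite lp rcons_path in hp E.
have [hp' Guv] := andP hp; exists (last r p).
have le1 := ldist_le_walk hp' erefl.
split=> //.
  by have := le_fst_llen le1; apply: contraL => /eqP->.
apply/le_anti; rewrite ldist_edge //= E.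
have := oplus_mono R v le1.
by rewrite /path_llen has_rcons size_rcons /= vr andbT.
Qed.

End LocalEquations.

Lemma dist_sym (V : finType) (G : sgraph V) s t : dist G s t = dist G t s.
Proof.
suff le s' t' : (dist G s' t' <= dist G t' s')%O by apply/le_anti; rewrite !le.
case: (dist_attained G t' s') => [->|[p /and3P[hp /eqP lp _] ->]].
  exact: le_enat_infty.
rewrite -[size p](size_belast t' p) -size_rev; apply: dist_le_walk.
  by rewrite -lp rev_path (eq_path (e' := G)) // => x y; apply: adj_sym.
by case: p {hp} lp => //= x p _; rewrite rev_cons last_rcons.
Qed.

(** * Runs of the priority queue search *)

Section SearchSpec.
Variables (V : finType) (disp : Order.disp_t) (K : orderType disp).
Variables (G' : sgraph V) (next : K -> V -> K) (bound : V -> K).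
Hypothesis le_next : forall k w, (k <= next k w)%O.
Variable Q0 : seq (K * V).
Implicit Types (Q : seq (K * V)) (A : {set V}) (k : K) (v w : V) (key : V -> K).

(* [key v] is the key under which [v] entered [A]; [generated A key k v] says that
   [(k, v)] is queued at the start or when some vertex enters [A]. *)
Definition generated A key k v : Prop :=
  (k, v) \in Q0 \/
  exists2 t, t \in A & [/\ G' t v, k = next (key t) v & (k <= bound v)%O].

(** The first clause is the monotonicity of the queue: nothing still waiting precedes a key already
    used. It lets later queue entries for a visited vertex be dropped. *)
Definition search_inv Q A key : Prop :=
  [/\ forall v q, v \in A -> q \in Q -> (key v <= q.1)%O,
      forall k v, generated A key k v -> (k, v) \in Q \/ v \in A /\ (key v <= k)%O,
      forall k v, (k, v) \in Q -> generated A key k v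
    & forall v, v \in A -> generated A key (key v) v].

Lemma search_loop_inv Q A A1 key :
  search_loop G' next bound Q A A1 -> search_inv Q A key ->
  exists key1, search_inv [::] A1 key1.
Proof.
move=> h; elim: h key => {Q A A1} [A|Q A A1 k v|Q A A1 k v].
- by move=> key; exists key.
- case/andP=> /= Qkv mkv Av _ IH key [I1 I2 I3 I4].
  apply: (IH key); split=> //.
  + by move=> w q Aw /mem_rem; apply: I1.
  + move=> k' w /I2[Qk'|]; last by right.
    have [[-> ->]|ne] := eqVneq (k', w) (k, v); last first.
      by left; rewrite (rem_mem ne).
    by right; split=> //; apply: (I1 v (k, v)).
  + by move=> k' w /mem_rem; apply: I3.
- case/andP=> /= Qkv mkv Av _ IH key [I1 I2 I3 I4].
  pose key1 w := if w == v then k else key w.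
  have key1v : key1 v = k by rewrite /key1 eqxx.
  have key1A w : w \in A -> key1 w = key w.
    by rewrite /key1; case: eqP => // ->; rewrite (negbTE Av).
  have gen_mono k' w : generated A key k' w -> generated (v |: A) key1 k' w.
    case=> [|[t At [Gtw E le]]]; [by left | right; exists t; rewrite ?inE ?At ?orbT //].
    by rewrite key1A.
  apply: (IH key1); split.
  + move=> w q; rewrite !inE mem_cat => /orP Aw /orP[/mem_rem Qq|].
      case: Aw => [/eqP->|Aw]; first by rewrite key1v; apply: (allP mkv).
      by rewrite key1A //; apply: I1.
    case/mapP=> x _ -> /=; apply: le_trans (le_next k x).
    case: Aw => [/eqP->|Aw]; first by rewrite key1v.
    by rewrite key1A //; apply: (I1 w (k, v)).
  + move=> k' w; have [->|wv] := eqVneq w v; last first.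
      move=> gen; have {gen} : generated A key k' w \/
          [/\ G' v w, k' = next k w & (k' <= bound w)%O].
        case: gen => [|[t]]; first by left; left.
        rewrite !inE => /predU1P[->|At]; first by rewrite key1v; right.
        by rewrite key1A //; left; right; exists t.
      case=> [/I2[Qk'|[Aw le]]|[Gvw -> le]].
      * left; rewrite mem_cat rem_mem //.
        by apply: contra wv => /eqP[_ ->].
      * by right; rewrite !inE Aw orbT key1A.
      left; rewrite mem_cat; apply/orP; right; apply/mapP; exists w => //.
      by rewrite mem_filter le mem_enum inE.
    (* No key for [v] can beat [k]: it was queued when the minimal [k] was chosen, or it comes from
       [v] itself and [le_next] applies. *)
    move=> gen; right; rewrite setU11 key1v; split=> //.
    case: gen => [Q0k|[t]].
      have [Qk'|[Av']] := I2 k' v (or_introl Q0k); last by rewrite Av' in Av.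
      exact: (allP mkv (k', v)).
    rewrite !inE => /predU1P[->|At].
      by rewrite key1v => -[_ -> _]; apply: le_next.
    rewrite key1A // => -[Gtv E le].
    have [|Qk'|[Av']] := I2 k' v; last by rewrite Av' in Av.
      by right; exists t.
    exact: (allP mkv (k', v)).
  + move=> k' w; rewrite mem_cat => /orP[/mem_rem/I3/gen_mono //|].
    case/mapP=> x; rewrite mem_filter mem_enum inE => /andP[le Gvx] [-> ->].
    by right; exists v; rewrite ?setU11 ?key1v.
  + move=> w; rewrite !inE => /predU1P[->|Aw]; first by rewrite key1v; apply/gen_mono/I3.
    by rewrite key1A //; apply/gen_mono/I4.
Qed.

(** With the queue exhausted only the keys remain, and [key v] is the least key generated for
    [v]. *)
Lemma search_loop_keys A :
  search_loop G' next bound Q0 set0 A ->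
  exists2 key, forall k v, generated A key k v -> v \in A /\ (key v <= k)%O
             & forall v, v \in A -> generated A key (key v) v.
Proof.
move=> /(@search_loop_inv _ _ _ bound)[|key [_ I2 _ I4]].
  split=> [v q|k v|k v|v]; rewrite ?inE //; last by left.
  by case=> [|[t]]; [left | rewrite inE].
by exists key => // k v /I2[].
Qed.

(** A visit shrinks the complement of [A], whatever it adds to the queue, and a skip shortens the
    queue. *)
Lemma search_loop_total Q A : exists A1, search_loop G' next bound Q A A1.
Proof.
have [n] := ubnP #|~: A|; elim: n A Q => // n IHn A Q lt_n.
have [m] := ubnP (size Q); elim: m Q => // m IHm Q lt_m.
case: (pickP (fun i : 'I_(size Q) => minimal_in Q (tnth (in_tuple Q) i))) => [i|no_min].
  case: (tnth _ _) => k v min_kv.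
  have Qkv : (k, v) \in Q by case/andP: min_kv.
  have [Av|nAv] := boolP (v \in A).
    have [|A1 h] := IHm (rem (k, v) Q); last by exists A1; apply: search_skip h.
    rewrite size_rem // -ltnS prednK //; by case: (Q) Qkv.
  have [|A1 h] := IHn (v |: A) (rem (k, v) Q ++
                 [seq (next k w, w) | w <- enum (nbr G' v) & (next k w <= bound w)%O]).
    rewrite -ltnS (leq_trans _ lt_n) // ltnS; apply: proper_card; rewrite properE.
    apply/andP; split; first by rewrite setCS subsetUr.
    by apply/subsetPn; exists v; rewrite !inE ?nAv ?eqxx.
  by exists A1; apply: search_visit h.
case: Q no_min {lt_m IHm} => [|q Q] no_min; first by exists A; apply: search_done.
pose i0 : 'I_(size (q :: Q)) := ord0.
case: (arg_minP (fun i => (tnth (in_tuple (q :: Q)) i).1) (erefl (xpredT i0))) => i _ mi.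
have := no_min i; rewrite /minimal_in mem_tnth andTb => /negP[].
by apply/allP=> x /(tnthP (in_tuple (q :: Q)))[j ->]; apply: mi.
Qed.

End SearchSpec.

(** * Keys and seeds of the two searches *)

Lemma ge_Fin0 (x : enat) : (x < Fin 0)%O = false.
Proof. by apply/negbTE; rewrite -leNgt; case: x. Qed.

Lemma lt_oplus_fst (V : finType) (R : {set V}) (x : llen) w :
  x.1 != Infty -> (x.1 < (oplus R x w).1)%O.
Proof. by case: x => [[n|] l] // _; rewrite oplus_fst lt_Fin. Qed.

Lemma le_succ_enat (x : enat) : (x <= enat_succ x)%O.
Proof. by case: x => // n; rewrite le_Fin. Qed.

(** The bound of the improved search: a key marked by a deletion may tie with [y], an unmarked one
    must be strictly better. *)
Lemma le_lkey_true (k : lkey) y :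
  (k <= mk_lkey y true)%O = if k.2 then (k.1 <= y)%O else (k.1 < y)%O.
Proof.
rewrite le_lkeyE /=; case: (k.2); first by rewrite implybT andbT.
by rewrite implybF -ltNge; case: ltgtP.
Qed.

Lemma le_lkey_oplus (V : finType) (R : {set V}) (k : lkey) w :
  (k <= mk_lkey (oplus R k.1 w) k.2)%O.
Proof.
rewrite le_lkeyE /= implybb implybT andbT.
by case: k => [[[n|] l] e] /=; rewrite ?llen_le_inf // le_llenE /= !le_Fin leqnSn ltnn.
Qed.

(** Both versions seed the queue by this scheme, with different [f]; [updates] absorbs the
    orientation in which an edge is stored. *)
Lemma mem_seeds (V : finType) (K : eqType) (B : batch V) (d : V -> enat)
    (f : V -> V -> bool -> K) k v :
  (k, v) \in flatten [seq (let: (a, b, e) := u in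
                 if (d a < d b)%O then [:: (f a b e, b)]
                 else if (d b < d a)%O then [:: (f b a e, a)] else [::])
               | u <- enum B] <->
  exists a e, [/\ updates B e a v, (d a < d v)%O & k = f a v e].
Proof.
split=> [/flatten_mapP[[[a b] e]]|[a [e [upd lt ->]]]].
  rewrite mem_enum => Bu; case: ltP => [lt|_].
    by rewrite inE => /eqP[-> ->]; exists a, e; rewrite /updates Bu.
  case: ltP => [lt|_]; rewrite ?inE // => /eqP[-> ->].
  by exists b, e; rewrite /updates Bu orbT.
have [upd'|upd'] := orP upd; apply/flatten_mapP.
  by exists (a, v, e); rewrite ?mem_enum // lt inE.
exists (v, a, e); rewrite ?mem_enum // ifF ?lt ?inE //.
by apply/negbTE; rewrite -leNgt ltW.
Qed.

(** * Vertices missed by BatchSearch are unaffected *)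

Section Affected.
Variables (V : finType) (G G' : sgraph V) (R : {set V}) (B : batch V) (r : V).
Hypothesis hG' : applies B G G'.
Implicit Types (u v w t a : V) (e : bool) (A : {set V}).

Let L := ldist G R r.
Let L' := ldist G' R r.

Lemma inserted_adj u v : updates B false u v -> G' u v.
Proof. by rewrite hG' => ->. Qed.

Lemma new_edge_inserted u v : G' u v -> ~~ G u v -> updates B false u v.
Proof. by rewrite hG' => /orP[//|/andP[->]]. Qed.

Lemma lost_edge_deleted u v : G u v -> ~~ G' u v -> updates B true u v.
Proof. by rewrite hG' negb_or => -> /andP[_]; rewrite negbK. Qed.

(** * The improved search *)

Section ImprovedSearch.
Variables (A : {set V}) (key : V -> lkey).

Let seeded v : Prop := exists a e,
  [/\ updates B e a v, ((L a).1 < (L v).1)%O & key v = mk_lkey (oplus R (L a) v) e].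

(** The three hypotheses are what [search_loop_keys] gives for the improved search, once the known
    values are replaced by the true ones. *)
Hypothesis seed_le : forall a v e,
  updates B e a v -> ((L a).1 < (L v).1)%O ->
  v \in A /\ (key v <= mk_lkey (oplus R (L a) v) e)%O.
Hypothesis push_le : forall t v, t \in A -> G' t v ->
  (mk_lkey (oplus R (key t).1 v) (key t).2 <= mk_lkey (L v) true)%O ->
  v \in A /\ (key v <= mk_lkey (oplus R (key t).1 v) (key t).2)%O.
Hypothesis key_origin : forall v, v \in A ->
  seeded v \/ exists2 t, t \in A &
    [/\ G' t v, key v = mk_lkey (oplus R (key t).1 v) (key t).2
       & (key v <= mk_lkey (L v) true)%O].

Lemma improved_root_notin : r \notin A.
Proof.
apply/negP=> /key_origin[[a [e [_ + _]]]|[t _ [_ -> /le_fst_lkey/le_fst_llen]]].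
  by rewrite /L ldist_root ge_Fin0.
by rewrite oplus_fst /L ldist_root; case: (key t).1.1.
Qed.

(** Consider the last edge [tu] of an optimal new path. If [u] improved but [t] did not, the edge
    was inserted and seeds [u]. If [t] was found in time, the key pushed along [tu] is strictly
    below [L u] and passes the bound with either mark. *)
Lemma improved_shorter u : (L u <= L' u)%O \/ u \in A /\ ((key u).1 <= L' u)%O.
Proof.
(* An infinite length is the greatest one, so induction may run on a bound for the finite
   distances. *)
case E': (L' u).1 => [n|]; last first.
  by left; rewrite [L' u](ldist_inf E') llen_le_inf.
have {E'} : ((L' u).1 < Fin n.+1)%O by rewrite E' lt_Fin.
elim: {n}n.+1 u => [|n IH] u; first by rewrite ge_Fin0.
have [->|ur] := eqVneq u r; first by left; rewrite /L /L' !ldist_root.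
have [E|[t [Gtu fin E]]] := ldist_pred G' R ur.
  by left; rewrite /L' E llen_le_inf.
rewrite /L' E oplus_fst lt_Fin_succ => /IH IHt.
have [le_u|lt_u] := leP (L u) (L' u); first by left; rewrite -E.
right; rewrite -E -/(L' u).
have Eu : L' u = oplus R (L' t) u by exact: E.
case: IHt => [le_t|[At le_t]].
  have lt_u' : (oplus R (L t) u < L u)%O.
    by apply: le_lt_trans lt_u; rewrite Eu; apply: oplus_mono.
  have nGtu : ~~ G t u.
    by apply/negP=> /(ldist_edge R r); rewrite leNgt lt_u'.
  have fin_t : (L t).1 != Infty.
    apply: contra fin => /eqP E1; have := le_fst_llen le_t.
    by rewrite E1 -/(L' t); case: (L' t).1.
  have lt_tu : ((L t).1 < (L u).1)%O.
    apply: lt_le_trans (lt_oplus_fst R u fin_t) _.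
    exact: le_fst_llen (ltW lt_u').
  have [Au le_k] := seed_le (new_edge_inserted Gtu nGtu) lt_tu.
  split=> //; apply: le_trans (le_fst_lkey le_k) _.
  by rewrite Eu; apply: oplus_mono.
have le_tu : (oplus R (key t).1 u <= L' u)%O by rewrite Eu; apply: oplus_mono.
have [|Au le_k] := push_le At Gtu.
  by apply/ltW/lt_fst_lkey/(le_lt_trans le_tu).
by split=> //; apply: le_trans (le_fst_lkey le_k) _.
Qed.

(* The first half bounds what deletions may break; the second says that a key
   without a deletion that improves on [L u] is witnessed by a path of [G'].
   Each half needs the other at smaller distances. *)
Lemma improved_longer n :
  (forall u, ((L u).1 < Fin n)%O ->
     (L' u <= L u)%O \/ u \in A /\ (key u <= mk_lkey (L u) true)%O) /\
  (forall u, u \in A -> ((key u).1.1 < Fin n)%O -> ~~ (key u).2 ->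
     ((key u).1 < L u)%O -> (L' u <= (key u).1)%O).
Proof.
elim: n => [|n [IHP IHQ]]; first by split=> u => [|_]; rewrite ge_Fin0.
split=> u.
  have [->|ur] := eqVneq u r; first by left; rewrite /L /L' !ldist_root.
  have [E|[t [Gtu fin E]]] := ldist_pred G R ur.
    by left; rewrite /L E llen_le_inf.
  have Eu : L u = oplus R (L t) u by exact: E.
  rewrite Eu oplus_fst lt_Fin_succ => lt_t.
  have [G'tu|nG'tu] := boolP (G' t u); last first.
    right; apply: seed_le; first exact: lost_edge_deleted.
    by rewrite Eu; apply: lt_oplus_fst.
  have edge x : (L' t <= x)%O -> (L' u <= oplus R x u)%O.
    by move=> /(oplus_mono R u); apply/le_trans/ldist_edge.
  case: (IHP t lt_t) => [/edge|[At le_k]]; first by left.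
  have le_x : ((key t).1 <= L t)%O := le_fst_lkey le_k.
  have le_xu := oplus_mono R u le_x.
  have push : (mk_lkey (oplus R (key t).1 u) (key t).2 <= mk_lkey (L u) true)%O ->
      u \in A /\ (key u <= mk_lkey (L u) true)%O.
    by move=> le_u; have [Au le_ku] := push_le At G'tu le_u; split;
       rewrite ?(le_trans le_ku).
  rewrite le_lkey_true /= Eu in push; rewrite le_lkey_true in le_k.
  case: (boolP (key t).2) le_k push => [_ _ push|nd lt_x push].
    by right; apply: push.
  have [lt_xu|ge_xu] := ltP (oplus R (key t).1 u) (oplus R (L t) u).
    by right; apply: push.
  (* The strict gain at [t] can vanish at [u], as [oplus] levels the flags when [u] is a landmark.
     The push may then fail, but the key of [t] is honest by the second half. *)
  left; apply: le_trans (edge _ _) le_xu; apply: IHQ => //.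
  exact: le_lt_trans (le_fst_llen le_x) lt_t.
move=> Au lt_n nd lt_u.
have inserted a : updates B false a u -> ((L a).1 < (L u).1)%O ->
    (key u).1 = oplus R (L a) u -> (L' u <= (key u).1)%O.
  move=> upd lt_au Eu; have G'au := inserted_adj upd.
  have lt_a : ((L a).1 < Fin n)%O by rewrite -lt_Fin_succ -(oplus_fst R _ u) -Eu.
  have edge x : (L' a <= x)%O -> (L' u <= oplus R x u)%O.
    by move=> /(oplus_mono R u); apply/le_trans/ldist_edge.
  case: (IHP a lt_a) => [/edge|[Aa le_k]]; first by rewrite Eu.
  have le_x : ((key a).1 <= L a)%O := le_fst_lkey le_k.
  have le_xu := oplus_mono R u le_x; rewrite -Eu in le_xu.
  have [|_ le_u] := push_le Aa G'au.
    exact/ltW/lt_fst_lkey/(le_lt_trans le_xu).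
  have Ex : (key u).1 = oplus R (key a).1 u.
    by apply/le_anti; rewrite le_xu (le_fst_lkey le_u).
  (* The pushed key ties with [key u] in its first part; as [key u] is unmarked and no larger, the
     pushed key is unmarked too. *)
  have nd_a : ~~ (key a).2.
    move: le_u; rewrite le_lkeyE /= Ex lexx /=.
    by apply: contraTN => ->; rewrite (negbTE nd).
  rewrite Ex; apply: edge; apply: IHQ => //.
    exact: le_lt_trans (le_fst_llen le_x) lt_a.
  by move: le_k; rewrite le_lkey_true (negbTE nd_a).
case: (key_origin Au) => [[a [e [upd lt_au Eu]]]|[t At [G'tu Eu _]]].
  by apply: (inserted a); rewrite ?Eu //; move: nd upd; rewrite Eu /= => /negbTE->.
have nd_t : ~~ (key t).2 by move: nd; rewrite Eu.
have lt_t : ((key t).1.1 < Fin n)%O.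
  by move: lt_n; rewrite Eu /= oplus_fst lt_Fin_succ.
have [lt_kt|le_kt] := ltP (key t).1 (L t).
  apply: le_trans (ldist_edge R r G'tu) _.
  by rewrite Eu; apply/oplus_mono/IHQ.
(* The key of [t] is no better than [L t], so the gain at [u] comes from an inserted edge [tu],
   whose seed attains the key of [u]. *)
have lt_Lt : (oplus R (L t) u < L u)%O.
  by apply: le_lt_trans lt_u; rewrite Eu; apply: oplus_mono.
have nGtu : ~~ G t u.
  by apply/negP=> /(ldist_edge R r); rewrite leNgt lt_Lt.
have upd := new_edge_inserted G'tu nGtu.
have lt_tu : ((L t).1 < (L u).1)%O.
  apply: lt_le_trans (lt_oplus_fst R u _) (le_fst_llen (ltW lt_Lt)).
  apply/negP=> /eqP E; have := le_lt_trans (le_fst_llen le_kt) lt_t.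
  by rewrite E ltNge.
apply: (inserted t) => //; apply/le_anti.
have [_ /le_fst_lkey -> /=] := seed_le upd lt_tu.
by rewrite Eu; apply: oplus_mono.
Qed.

Lemma improved_unaffected v : v \notin A -> L' v = L v.
Proof.
move=> nAv; apply/le_anti/andP; split; last first.
  by case: (improved_shorter v) => // -[Av]; rewrite Av in nAv.
case E: (L v).1 => [n|]; last first.
  by rewrite [L v](ldist_inf E) llen_le_inf.
have [/(_ v) longer _] := improved_longer n.+1.
by case: longer => [|//|[Av]]; [rewrite E lt_Fin | rewrite Av in nAv].
Qed.

End ImprovedSearch.

(** * The basic search *)

Section BasicSearch.
Variables (A : {set V}) (key : V -> enat).

Let d u := (L u).1.

Hypothesis seed_le : forall a v e,
  updates B e a v -> (d a < d v)%O -> v \in A /\ (key v <= enat_succ (d a))%O.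
Hypothesis push_le : forall t v, t \in A -> G' t v ->
  (enat_succ (key t) <= d v)%O -> v \in A /\ (key v <= enat_succ (key t))%O.
Hypothesis key_origin : forall v, v \in A ->
  (exists a e, [/\ updates B e a v, (d a < d v)%O & key v = enat_succ (d a)])
  \/ exists2 t, t \in A &
    [/\ G' t v, key v = enat_succ (key t) & (key v <= d v)%O].

Lemma basic_key_le v : v \in A -> (key v <= d v)%O.
Proof. by move=> /key_origin[[a [e [_ /enat_succ_le le ->]]]|[t _ []]]. Qed.

Lemma basic_root_notin : r \notin A.
Proof.
apply/negP=> /key_origin[[a [e [_ + _]]]|[t _ [_ -> ]]].
  by rewrite /d /L ldist_root ge_Fin0.
by rewrite /d /L ldist_root; case: (key t).
Qed.

Lemma basic_shorter u : (d u <= (L' u).1)%O \/ u \in A /\ (key u <= (L' u).1)%O.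
Proof.
case E': (L' u).1 => [n|]; last by left; apply: le_enat_infty.
rewrite -E'; have {E'} : ((L' u).1 < Fin n.+1)%O by rewrite E' lt_Fin.
elim: {n}n.+1 u => [|n IH] u; first by rewrite ge_Fin0.
have [->|ur] := eqVneq u r; first by left; rewrite /d /L /L' !ldist_root.
have [E|[t [Gtu _ E]]] := ldist_pred G' R ur.
  by left; rewrite /L' E le_enat_infty.
rewrite {1}/L' E oplus_fst lt_Fin_succ => /IH IHt.
have {E} Eu : (L' u).1 = enat_succ (L' t).1 by rewrite /L' E oplus_fst.
have [le_u|lt_u] := leP (d u) (L' u).1; [by left | right].
rewrite Eu in lt_u *; case: IHt => [le_t|[At le_t]].
  have le_tu : (enat_succ (d t) <= enat_succ (L' t).1)%O by rewrite le_enat_succ.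
  have lt_tu : (d t < d u)%O.
    exact: le_lt_trans (le_trans (le_succ_enat _) le_tu) lt_u.
  have nGtu : ~~ G t u.
    apply/negP=> /(ldist_edge R r)/le_fst_llen; rewrite oplus_fst leNgt.
    by rewrite (le_lt_trans le_tu).
  have [Au le_k] := seed_le (new_edge_inserted Gtu nGtu) lt_tu.
  by split=> //; apply: le_trans le_tu.
have le_tu : (enat_succ (key t) <= enat_succ (L' t).1)%O by rewrite le_enat_succ.
have [|Au le_k] := push_le At Gtu; first exact/ltW/(le_lt_trans le_tu).
by split=> //; apply: le_trans le_tu.
Qed.

(** A lost edge would seed [v]; and if [u] were in [A], [basic_key_le] would let its push to [v]
    pass the bound. So old shortest paths to missed vertices survive and stay outside [A]. *)
Lemma basic_pred_notin u v : v \notin A -> G u v ->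
  (d u < d v)%O -> d v = enat_succ (d u) -> u \notin A /\ G' u v.
Proof.
move=> nAv Guv lt_uv E; have G'uv : G' u v.
  apply: contraR nAv => nG'uv.
  by have [] := seed_le (lost_edge_deleted Guv nG'uv) lt_uv.
split=> //; apply: contra nAv => Au; have [|//] := push_le Au G'uv.
by rewrite E le_enat_succ; apply: basic_key_le.
Qed.

Lemma basic_longer v : v \notin A -> (L' v <= L v)%O.
Proof.
case E: (d v) => [n|]; last by rewrite [L v](ldist_inf E) llen_le_inf.
have {E} : (d v < Fin n.+1)%O by rewrite E lt_Fin.
elim: {n}n.+1 v => [|n IH] v; first by rewrite ge_Fin0.
have [->|vr] := eqVneq v r; first by rewrite /L /L' !ldist_root.
have [E|[u [Guv fin E]]] := ldist_pred G R vr.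
  by rewrite /L E llen_le_inf.
rewrite /d /L E oplus_fst lt_Fin_succ => lt_u nAv.
have [||nAu G'uv] := basic_pred_notin nAv Guv; rewrite ?/d ?/L ?E ?oplus_fst //.
  by rewrite -(oplus_fst R _ v); apply: lt_oplus_fst.
apply: le_trans (ldist_edge R r G'uv) _.
by apply: oplus_mono; apply: IH.
Qed.

(** The flags must agree as well as the distances. So the predecessor of [v] on a best new path is
    shown to precede [v] on an old shortest path and to lie outside [A], where induction applies. *)
Lemma basic_unaffected v : v \notin A -> L' v = L v.
Proof.
move=> nAv; apply/le_anti; rewrite basic_longer //=.
case E: (L' v).1 => [n|]; last by rewrite [L' v](ldist_inf E) llen_le_inf.
have {E} : ((L' v).1 < Fin n.+1)%O by rewrite E lt_Fin.
elim: {n}n.+1 v nAv => [|n IH] v nAv; first by rewrite ge_Fin0.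
have [->|vr] := eqVneq v r; first by rewrite /L /L' !ldist_root.
have [E|[u [G'uv fin E]]] := ldist_pred G' R vr.
  by rewrite /L' E llen_le_inf.
have Ev : (L' v).1 = enat_succ (L' u).1 by rewrite /L' E oplus_fst.
rewrite Ev lt_Fin_succ => lt_u.
have Edv : d v = (L' v).1.
  apply/le_anti; rewrite (le_fst_llen (basic_longer nAv)) andbT.
  by case: (basic_shorter v) => // -[Av]; rewrite Av in nAv.
have le_du : (d u <= (L' u).1)%O.
  case: (basic_shorter u) => // -[Au le_k].
  have [|Av] := push_le Au G'uv; first by rewrite Edv Ev le_enat_succ.
  by rewrite Av in nAv.
have lt_uv : (d u < d v)%O.
  rewrite Edv Ev; apply: le_lt_trans le_du _.
  by rewrite -(oplus_fst R _ v); apply: lt_oplus_fst.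
have Guv : G u v.
  apply: contraR nAv => nGuv.
  by have [] := seed_le (new_edge_inserted G'uv nGuv) lt_uv.
have Ed : d v = enat_succ (d u).
  apply/le_anti; rewrite enat_succ_le // andbT.
  by have := le_fst_llen (ldist_edge R r Guv); rewrite oplus_fst.
have [nAu _] := basic_pred_notin nAv Guv lt_uv Ed.
apply: le_trans (ldist_edge R r Guv) _.
by rewrite [L' v]E; apply/oplus_mono/IH.
Qed.

End BasicSearch.

End Affected.

Lemma batch_search_unaffected (V : finType) (G G' : sgraph V) (R : {set V})
    (B : batch V) (Gamma : labelling V) (ver : version) r A :
  applies B G G' -> minimal_hc_labelling R G Gamma -> r \in R ->
  batch_search G' B R Gamma ver r A ->
  r \notin A /\ forall v, v \notin A -> ldist G' R r v = ldist G R r v.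
Proof.
move=> hG' hGamma Rr.
have dE v : known_dist R Gamma r v = (ldist G R r v).1.
  by rewrite ldist_dist; apply: known_distE Rr; case: hGamma.
have dLE v : known_ldist R Gamma r v = ldist G R r v by apply: known_ldistE.
case: ver => /=.
- move=> /search_loop_keys[k _|key gen origin]; first exact: le_succ_enat.
  have seed a v e : updates B e a v ->
      ((ldist G R r a).1 < (ldist G R r v).1)%O ->
      v \in A /\ (key v <= enat_succ (ldist G R r a).1)%O.
    move=> upd lt; apply: gen; left; apply/mem_seeds; exists a, e.
    by rewrite !dE.
  have push t v : t \in A -> G' t v ->
      (enat_succ (key t) <= (ldist G R r v).1)%O ->
      v \in A /\ (key v <= enat_succ (key t))%O.
    by move=> At Gtv le; apply: gen; right; exists t; rewrite ?dE.
  have {}origin v : v \in A -> (exists a e, [/\ updates B e a v,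
        ((ldist G R r a).1 < (ldist G R r v).1)%O & key v = enat_succ (ldist G R r a).1])
      \/ exists2 t, t \in A &
        [/\ G' t v, key v = enat_succ (key t) & (key v <= (ldist G R r v).1)%O].
    move=> /origin[/mem_seeds[a [e [upd lt E]]]|[t At [Gtv E le]]].
      by left; exists a, e; rewrite -!dE.
    by right; exists t; rewrite // -dE.
  split; first exact: basic_root_notin origin.
  exact: (basic_unaffected hG' seed push origin).
- move=> /search_loop_keys[k w|key gen origin]; first exact: le_lkey_oplus.
  have seed a v e : updates B e a v ->
      ((ldist G R r a).1 < (ldist G R r v).1)%O ->
      v \in A /\ (key v <= mk_lkey (oplus R (ldist G R r a) v) e)%O.
    move=> upd lt; apply: gen; left; apply/mem_seeds; exists a, e.
    by rewrite !dE dLE.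
  have push t v : t \in A -> G' t v ->
      (mk_lkey (oplus R (key t).1 v) (key t).2 <= mk_lkey (ldist G R r v) true)%O ->
      v \in A /\ (key v <= mk_lkey (oplus R (key t).1 v) (key t).2)%O.
    by move=> At Gtv le; apply: gen; right; exists t; rewrite ?dLE.
  have {}origin v : v \in A -> (exists a e, [/\ updates B e a v,
        ((ldist G R r a).1 < (ldist G R r v).1)%O
        & key v = mk_lkey (oplus R (ldist G R r a) v) e])
      \/ exists2 t, t \in A &
        [/\ G' t v, key v = mk_lkey (oplus R (key t).1 v) (key t).2
          & (key v <= mk_lkey (ldist G R r v) true)%O].
    move=> /origin[/mem_seeds[a [e [upd lt E]]]|[t At [Gtv E le]]].
      by left; exists a, e; rewrite -!dE -dLE.
    by right; exists t; rewrite // -dLE.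
  split; first exact: improved_root_notin origin.
  exact: (improved_unaffected hG' seed push origin).
Qed.

Lemma batch_search_total (V : finType) (G' : sgraph V) (R : {set V})
    (B : batch V) (Gamma : labelling V) (ver : version) r :
  exists A, batch_search G' B R Gamma ver r A.
Proof. by case: ver; apply: search_loop_total. Qed.

(** What [repair_label] stores for a value; on landmark lengths from a landmark it is the canonical
    label, except at the root. *)
Definition entry (dl : llen) : option enat :=
  if (dl.1 == Infty) || dl.2 then None else Some dl.1.

(** * BatchRepair *)

Section Repair.
Variables (V : finType) (G' : sgraph V) (R : {set V}) (r : V).
Implicit Types (u v w x y : V) (A : {set V}) (D : V -> llen) (Gam : labelling V).

(** A pointwise description of writing [l] on [P]: the order of the writes disappears, and
    successive rounds compose by [predU]. *)
Definition repaired (P : pred V) (l : V -> llen) Gam Gam1 : Prop :=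
  (forall v u, label Gam1 v u =
     if (u == r) && P v then entry (l v) else label Gam v u) /\
  (forall x y, hwy Gam1 x y =
     if [&& x == r, y \in R & P y] then (l y).1
     else if [&& y == r, x \in R & P x] then (l x).1 else hwy Gam x y).

Lemma repaired_trans P P1 l Gam Gam1 Gam2 :
  repaired P l Gam Gam1 -> repaired P1 l Gam1 Gam2 ->
  repaired (predU P P1) l Gam Gam2.
Proof.
move=> [lab1 hwy1] [lab2 hwy2]; split=> [v u|x y] /=.
  by rewrite lab2 lab1 /=; case: (u == r); case: (P v); case: (P1 v).
rewrite hwy2 hwy1 /=; have [->|] := eqVneq x r; have [->|] := eqVneq y r => //=.
- by case: (r \in R); case: (P r); case: (P1 r).
- by case: (y \in R); case: (P y); case: (P1 y).
- by case: (x \in R); case: (P x); case: (P1 x).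
Qed.

Lemma eq_repaired P P1 l l1 Gam Gam1 :
  P =1 P1 -> {in P, l =1 l1} -> repaired P l Gam Gam1 -> repaired P1 l1 Gam Gam1.
Proof.
move=> eqP eql [lab1 hwy1]; split=> [v u|x y]; rewrite ?lab1 ?hwy1 -!eqP.
  by case Pv: (P v); rewrite ?andbF // (eql v Pv).
case Px: (P x); case Py: (P y); rewrite ?andbF //.
- by rewrite (eql x Px) (eql y Py).
- by rewrite (eql x Px).
- by rewrite (eql y Py).
Qed.

Lemma repaired_label v l Gam :
  repaired (pred1 v) l Gam (repair_label R r v (l v) Gam).
Proof.
split=> [x u|x y] /=.
  by rewrite xpair_eqE andbC; case: (u == r) => //=; have [->|] := eqVneq x v.
rewrite !xpair_eqE.
have [->|xr] := eqVneq x r; have [->|yr] := eqVneq y r => /=;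
  rewrite ?andbF ?orbF ?andbT /= ?[r == v]eq_sym.
- by have [->|_] := eqVneq v r; rewrite ?orbT ?andbT ?andbF /=; case: (r \in R).
- by have [->|_] := eqVneq y v; rewrite ?andbF // andbT.
- by have [->|_] := eqVneq x v; rewrite ?andbF // andbT.
- by [].
Qed.

(** As [s] avoids [A], relaxation never alters a value still to be written. The last three clauses
    describe [D1] by upper and lower bounds instead of a formula for the minimum. *)
Lemma foldl_repair A s D Gam D1 Gam1 :
  {in s, forall v, v \notin A} ->
  foldl (repair_vertex G' R r A) (D, Gam) s = (D1, Gam1) ->
  [/\ repaired [in s] D Gam Gam1,
      forall u, (D1 u <= D u)%O,
      forall u v, u \in A -> v \in s -> G' v u -> (D1 u <= oplus R (D v) u)%O
    & forall u (x : llen), (x <= D u)%O ->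
        (forall v, v \in s -> G' v u -> (x <= oplus R (D v) u)%O) -> (x <= D1 u)%O].
Proof.
elim: s D Gam => [|v s IH] D Gam sA /=.
  by case=> <- <-; split=> //; split=> [v u|x y]; rewrite ?andbF.
set D2 := fun w => _ => /IH[w sw|rep le1 le2 le3]; first by rewrite sA ?inE ?sw ?orbT.
have D2E u : u \notin A -> D2 u = D u by rewrite /D2 !inE => /negbTE->; rewrite andbF.
have D2le u : (D2 u <= D u)%O by rewrite /D2; case: ifP => // _; rewrite ge_min lexx.
split.
- have {}rep : repaired [in s] D (repair_label R r v (D v) Gam) Gam1.
    by apply: eq_repaired rep => // u su; rewrite D2E // sA // inE su orbT.
  by apply: eq_repaired (repaired_trans (repaired_label v D Gam) rep).
- by move=> u; apply: le_trans (le1 u) (D2le u).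
- move=> u w Au; rewrite inE => /predU1P[->|sw] Gwu.
    by apply: le_trans (le1 u) _; rewrite /D2 !inE Gwu Au /= ge_min lexx orbT.
  by rewrite -(D2E w) ?le2 // sA // inE sw orbT.
- move=> u x le_x le_s; apply: le3 => [|w sw Gwu].
    rewrite /D2; case: ifP => //; rewrite !inE => /andP[Gvu _].
    by rewrite le_min le_x le_s ?inE ?eqxx.
  by rewrite D2E ?le_s ?sA // inE sw orbT.
Qed.

Let L' := ldist G' R r.

(** Dijkstra's argument, for all vertices of least distance at once: an optimal path to a vertex of
    [A] must enter [A] from outside, so no true distance in [A] is below that minimum. *)
Lemma argmin_dist_exact A D :
  r \notin A ->
  (forall v, v \in A -> (L' v <= D v)%O) ->
  (forall v w, v \in A -> w \notin A -> G' v w -> (D v <= oplus R (L' w) v)%O) ->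
  {in argmin_dist A D, D =1 L'}.
Proof.
move=> nAr leD Dle v; rewrite inE => /andP[Av /forall_inP/= minv].
have ner u : u \in A -> u != r by apply: contraTneq => ->.
have far u : u \in A -> ((D v).1 <= (L' u).1)%O.
  case E': (L' u).1 => [n|]; last by rewrite le_enat_infty.
  rewrite -E'; have {E'} : ((L' u).1 < Fin n.+1)%O by rewrite E' lt_Fin.
  elim: {n}n.+1 u => [|n IH] u; first by rewrite ge_Fin0.
  move=> lt_u Au; case: (ldist_pred G' R (ner _ Au)) => [E|[w [Gwu _ E]]].
    by rewrite /L' E le_enat_infty.
  have [Aw|nAw] := boolP (w \in A).
    move: lt_u; rewrite /L' E oplus_fst lt_Fin_succ => /IH/(_ Aw) le_w.
    exact: le_trans le_w (le_succ_enat _).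
  apply: le_trans (minv u Au) _; rewrite /L' E; apply/le_fst_llen/Dle => //.
  by rewrite adj_sym.
apply/le_anti; rewrite leD // andbT.
case: (ldist_pred G' R (ner _ Av)) => [E|[w [Gwv fin E]]].
  by rewrite /L' E llen_le_inf.
have [Aw|nAw] := boolP (w \in A); last by rewrite /L' E Dle // adj_sym.
(* A predecessor in [A] is at least as far as [(D v).1], so [v] would be strictly farther; the
   inequality wanted holds by this alone. *)
apply/ltW/lt_fst_llen/(le_lt_trans (far w Aw)).
by rewrite [L' v]E; apply: lt_oplus_fst.
Qed.

(** The two bounds on [D] are the loop invariant: never too small on [A], and no worse than what
    exact values outside [A] offer. Removed vertices have exact values and so may join the
    outside. *)
Lemma repair_loop_exact A D Gam Gam2 :
  repair_loop G' R r A D Gam Gam2 -> r \notin A ->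
  (forall v, v \in A -> (L' v <= D v)%O) ->
  (forall v w, v \in A -> w \notin A -> G' v w -> (D v <= oplus R (L' w) v)%O) ->
  repaired [in A] L' Gam Gam2.
Proof.
elim=> {A D Gam Gam2} [D Gam|A D Gam D1 Gam1 Gam2 s A0 perm_s].
  by move=> _ _ _; split=> [v u|x y]; rewrite ?inE ?andbF.
set M := argmin_dist A D => hs _ IH nAr leD Dle.
have exact := argmin_dist_exact nAr leD Dle.
have sM : s =i M by move=> v; rewrite (perm_mem perm_s) mem_enum.
have MA : M \subset A by apply/subsetP=> v; rewrite inE => /andP[].
have [|rep le1 le2 le3] := foldl_repair _ hs; first by move=> v; rewrite sM !inE => ->.
apply: (@eq_repaired (predU [in s] [in A :\: M]) _ L') => //.
  move=> v; rewrite /= sM in_setD; case: (boolP (v \in M)) => //= Mv.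
  by rewrite (subsetP MA).
have {}rep : repaired [in s] L' Gam Gam1.
  by apply: eq_repaired rep => // v /=; rewrite sM; apply: exact.
apply: repaired_trans rep _; apply: IH => [|v|v w].
- by rewrite in_setD (negbTE nAr) andbF.
- rewrite in_setD => /andP[_ Av]; apply: le3; first exact: leD.
  by move=> w; rewrite sM => Mw Gwv; rewrite exact //; apply: ldist_edge.
- rewrite !in_setD => /andP[nMv Av]; rewrite negb_and negbK => /orP[Mw|nAw] Gvw.
    by rewrite -(exact w Mw); apply: le2; rewrite ?in_setD ?nMv ?sM // adj_sym.
  exact: le_trans (le1 v) (Dle _ _ Av nAw Gvw).
Qed.

Lemma repair_loop_total A D Gam : exists Gam2, repair_loop G' R r A D Gam Gam2.
Proof.
have [n] := ubnP #|A|; elim: n A D Gam => // n IH A D Gam lt_n.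
have [->|A0] := eqVneq A set0; first by exists Gam; apply: repair_done.
case E: (foldl (repair_vertex G' R r (A :\: argmin_dist A D)) (D, Gam)
           (enum (argmin_dist A D))) => [D1 Gam1].
have [|Gam2 h] := IH (A :\: argmin_dist A D) D1 Gam1; last first.
  by exists Gam2; apply: repair_step (perm_refl _) E h.
rewrite -ltnS (leq_trans _ lt_n) // ltnS; apply: proper_card.
rewrite properE subsetDl /=; case/set0Pn: A0 => v0 Av0.
case: (arg_minP (fun v => (D v).1) Av0) => v Pv minv; have {Pv} Av : v \in A := Pv.
apply/subsetPn; exists v => //; rewrite !inE Av andbT negbK /=.
exact/forall_inP.
Qed.

End Repair.

(** * The canonical labelling *)

Section Canonical.
Variables (V : finType) (R : {set V}).
Implicit Types (G : sgraph V) (Gamma : labelling V) (r u v : V).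

Local Notation canon G := (label (canonical_labelling R G)).

(** A landmark [v] itself witnesses [through] when reachable, so both sides are empty. The root is
    excluded: its length is (0, False), which [entry] would turn into a label. *)
Lemma entry_ldist G r v :
  r \in R -> v != r -> entry (ldist G R r v) = canon G v r.
Proof.
move=> Rr vr; rewrite /entry ldist_through ldist_dist /= Rr.
have [E|fin] /= := eqVneq (dist G r v) Infty; first by rewrite andbF.
have [Rv|//] := boolP (v \in R); last by case: through.
suff -> : through G R r v by [].
apply/exists_inP; exists v; rewrite // vr dist_refl.
by case: (dist G r v) => //= n; rewrite addn0.
Qed.

Lemma canon_root G r : r \in R -> canon G r r = None.
Proof. by move=> Rr; rewrite /= Rr. Qed.

Lemma canon_landmark G v r : r \notin R -> canon G v r = None.
Proof. by move=> /negbTE nRr; rewrite /= nRr andbF. Qed.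

Lemma minimal_label_canon G Gamma v r :
  minimal_hc_labelling R G Gamma -> label Gamma v r = canon G v r.
Proof.
move=> hG; have := minimal_labelE r v hG; have [[hc _ _] _] := hG.
case E: (label Gamma v r) => [d|] /=; last by move=> <-.
by move=> <-; have [_ ->] := hc _ _ _ E.
Qed.

(** The highway need agree on landmarks only, since labels exist only for landmarks; minimality
    comes from [label_needed]. *)
Lemma canonical_minimal G Gamma :
  (forall v r, label Gamma v r = canon G v r) ->
  {in R &, forall x y, hwy Gamma x y = dist G x y} ->
  minimal_hc_labelling R G Gamma.
Proof.
move=> labE hwyE; have [hc1 hc2 hc3] := canonical_labellingP R G.
split; first split.
- by move=> v r d; rewrite labE; apply: hc1.
- by move=> r1 r2 R1 R2; apply: hwyE.
- move=> v r nRv Rr; rewrite (hc3 _ _ nRv Rr); apply: eq_big => s; rewrite labE //.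
  case E: (canon G v s) => [d|//] _; congr enat_add.
  by have [Rs _] := hc1 _ _ _ E; rewrite hwyE.
move=> Gamma1 hG1; apply: leq_sum => v _; apply/subset_leq_card/subsetP=> s.
rewrite !inE labE /=; case: ifP => // /and4P[nRv Rs fin nthr] _.
exact: label_needed hG1 nRv Rs fin nthr.
Qed.

End Canonical.

(** * The loop over the landmarks *)

Section LandmarkLoop.
Variables (V : finType) (G G' : sgraph V) (R : {set V}) (B : batch V).
Variables (Gamma : labelling V) (ver : version).
Hypotheses (hG' : applies B G G') (hGamma : minimal_hc_labelling R G Gamma).

Local Notation canon H := (label (canonical_labelling R H)).

(** Off [A] old and new lengths agree, so the initial values, though computed from [Gamma], satisfy
    the loop invariant for [G']. *)
Lemma batch_repair_exact r (A : {set V}) Gam Gam1 :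
  r \in R -> r \notin A ->
  (forall v, v \notin A -> ldist G' R r v = ldist G R r v) ->
  batch_repair G' R Gamma r A Gam Gam1 ->
  repaired R r [in A] (ldist G' R r) Gam Gam1.
Proof.
move=> Rr nAr unaff /repair_loop_exact; apply=> // [v Av|v w Av nAw Gvw].
  apply: le_bigmin => [|w]; first exact: llen_le_inf.
  rewrite !inE => /andP[nAw Gvw]; rewrite (known_ldistE w hGamma) // -unaff //.
  by apply: ldist_edge; rewrite adj_sym.
rewrite unaff // -(known_ldistE w hGamma) //; apply: bigmin_inf (lexx _).
by rewrite !inE nAw.
Qed.

(** The labels of a landmark are those of [G] while it waits in [s], and those of [G'] afterwards. A
    highway entry may be renewed early, from its other end, hence the disjunction. *)
Lemma landmark_loop_exact s Gam Gam' :
  landmark_loop G' B R Gamma ver s Gam Gam' -> uniq s -> {subset s <= R} ->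
  (forall v u, label Gam v u = canon (if u \in s then G else G') v u) ->
  {in R &, forall x y, hwy Gam x y = dist G' x y \/
                       x \in s /\ hwy Gam x y = dist G x y} ->
  (forall v u, label Gam' v u = canon G' v u) /\
  {in R &, forall x y, hwy Gam' x y = dist G' x y}.
Proof.
elim=> {s Gam Gam'} [Gam _ _ lab hwyE|r s A Gam Gam1 Gam2 search repair _ IH].
  by split=> // x y Rx Ry; have [//|[]] := hwyE x y Rx Ry.
move=> /= /andP[nsr us] sR lab hwyE.
have Rr : r \in R by apply: sR; rewrite mem_head.
have [nAr unaff] := batch_search_unaffected hG' hGamma Rr search.
have [lab1 hwy1] := batch_repair_exact Rr nAr unaff repair.
apply: IH => // [u su|v u|x y Rx Ry].
- by apply: sR; rewrite inE su orbT.
- have -> : label Gam1 v u = if (u == r) && (v \in A) then entry (ldist G' R r v)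
                              else label Gam v u by apply: lab1.
  rewrite lab inE; have [->|//] := eqVneq u r.
  rewrite (negbTE nsr); case: (boolP (v \in A)) => [Av|nAv].
    by apply: entry_ldist => //; apply: contraNneq nAr => <-.
  have [->|vr] := eqVneq v r.
    exact: etrans (canon_root _ Rr) (esym (canon_root _ Rr)).
  by rewrite -(entry_ldist G' Rr vr) unaff // entry_ldist.
rewrite hwy1 /=; have [->|xr] /= := eqVneq x r.
  rewrite Ry /=; case: (boolP (y \in A)) => [_|nAy].
    by left; rewrite ldist_dist.
  (* Nothing is written here: the entry is either renewed already, or old, and off [A] an old
     distance is also the new one. *)
  rewrite (negbTE nAr) !andbF; left.
  have [//|[_ ->]] := hwyE r y Rr Ry.
  by rewrite -(ldist_dist G R) -unaff // ldist_dist.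
case: ifP => [/and3P[/eqP-> _ _]|_].
  by left; rewrite ldist_dist dist_sym.
have [|[]] := hwyE x y Rx Ry; first by left.
by rewrite inE (negbTE xr); right.
Qed.

Lemma landmark_loop_total s Gam :
  exists Gam', landmark_loop G' B R Gamma ver s Gam Gam'.
Proof.
elim: s Gam => [|r s IH] Gam; first by exists Gam; apply: landmark_done.
have [A search] := batch_search_total G' R B Gamma ver r.
have [Gam1 repair] := repair_loop_total G' R r A
  (fun v => \big[Order.min/llen_inf]_(w in nbr G' v :\: A)
              oplus R (known_ldist R Gamma r w) v) Gam.
have [Gam' loop] := IH Gam1; exists Gam'.
exact: landmark_step search repair loop.
Qed.

End LandmarkLoop.

Theorem theorem5p21 (V : finType) (G G' : sgraph V) (R : {set V}) (B : batch V)
    (Gamma : labelling V) (ver : version)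
    (hB : batch_update B G) (hG' : applies B G G')
    (hGamma : minimal_hc_labelling R G Gamma) :
  (exists Gamma', batchHL G' B R Gamma ver Gamma') /\
  (forall Gamma', batchHL G' B R Gamma ver Gamma' ->
     minimal_hc_labelling R G' Gamma').
Proof.
split=> [|Gamma' [s perm_s loop]].
  have [Gamma' loop] := landmark_loop_total G' R B Gamma ver (enum R) Gamma.
  by exists Gamma'; exists (enum R).
have sR : s =i R by move=> v; rewrite (perm_mem perm_s) mem_enum.
have [|v|v u|x y Rx Ry|labE hwyE] := landmark_loop_exact hG' hGamma loop.
- by rewrite (perm_uniq perm_s) enum_uniq.
- by rewrite sR.
(* For [u] outside [R] the invariant asks for the label over [G'], but there both graphs have
   none. *)
- rewrite sR (minimal_label_canon _ _ hGamma); case: (boolP (u \in R)) => // nRu.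
  by rewrite !canon_landmark.
- by right; rewrite sR; split=> //; case: hGamma => -[_ hH _] _; apply: hH.
exact: canonical_minimal labE hwyE.
Qed.
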